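(* Let $n$ and $l$ be positive integers. The height of the set of all words over an $l$-letter ordered alphabet that are not $n$-divisible, with respect to the set of words of length less than $n$, does not exceed $\Phi(n,l)$, where $$\Phi(n,l)=2^{40}\, l\cdot n^{38+8\log_2 n}.$$
   Context: Words are finite words over an alphabet $a_1\prec a_2\prec\dots\prec a_l$. The order on letters induces the (partial) lexicographic order on words: two words, one of which is a prefix of the other, are called incomparable; otherwise the words are compared by the letters at the first position where they differ. The notation $u\succ v$ means that $u$ and $v$ are comparable and $u$ is lexicographically larger than $v$. A word $W$ is $n$-divisible if it can be written as $W=vu_1u_2\cdots u_n$ with words $v,u_1,\dots,u_n$ such that $u_1\succ u_2\succ\dots\succ u_n$. A set $M$ of words has height $h$ over a set of words $Y$ if $h$ is the least number such that every word of $M$ can be written in the form $u_1^{k_1}u_2^{k_2}\cdots u_r^{k_r}$ with $u_1,\dots,u_r\in Y$, nonnegative integers $k_i$, and $r\leqslant h$. *)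

(* Defs.v *)
From mathcomp Require Import all_boot all_order all_algebra.
From mathcomp Require Import classical_sets reals exp.

Set Implicit Arguments.
Unset Strict Implicit.
Unset Printing Implicit Defensive.

Import Order.TTheory GRing.Theory Num.Theory.

Local Open Scope classical_set_scope.

Section Words.
Context {d : Order.disp_t} {A : orderType d}.
Implicit Types (u v w : seq A) (M Y : set (seq A)).

Definition word_comparable u v : bool := ~~ prefix u v && ~~ prefix v u.

(* [seqlexi A] is totally ordered, a proper prefix being smaller than the
   whole word; here such pairs are incomparable. *)
Definition lex_gt u v : bool :=
  word_comparable u v && (v < u :> seqlexi A)%O.

Lemma lex_gtP u v :
  reflect (exists p a b u' v',
             [/\ u = p ++ a :: u', v = p ++ b :: v' & (b < a)%O])
          (lex_gt u v).
Proof.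
rewrite /lex_gt /word_comparable; apply: (iffP idP); last first.
  move=> [p [a [b [u' [v' [-> -> ba]]]]]].
  elim: p => [|x p IH] /=; last by rewrite !eqxx /= ltxi_cons lexx /=.
  by rewrite ltxi_cons (gt_eqF ba) (lt_eqF ba) (ltW ba) leNgt ba.
elim: u v => [|a u IH] [|b v] //=; rewrite ltxi_cons.
case: (ltgtP a b) => [||<-] //=.
- by exists [::], a, b, u, v.
- by move=> /IH [p [x [y [u' [v' [-> -> yx]]]]]]; exists (a :: p), x, y, u', v'.
Qed.

(* [lex_gt] is transitive and irreflexive, so [sorted] expresses the whole
   chain.  For [n >= 2] it forces the factors to be nonempty. *)
Definition n_divisible (n : nat) : set (seq A) :=
  [set w | exists v (u : n.-tuple (seq A)),
     w = v ++ flatten u /\ sorted lex_gt u].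

Definition word_exp u (k : nat) : seq A := flatten (nseq k u).

Definition height_at_most M Y (h : nat) : Prop :=
  forall w, M w -> exists s : seq (seq A * nat),
    [/\ (size s <= h)%N,
        forall p, p \in s -> Y p.1
      & w = flatten [seq word_exp p.1 p.2 | p <- s]].

Definition has_height M Y (h : nat) : Prop :=
  height_at_most M Y h /\
  forall h', height_at_most M Y h' -> (h <= h')%N.

Definition words_shorter_than (n : nat) : set (seq A) :=
  [set w | (size w < n)%N].

End Words.

Local Open Scope ring_scope.

Definition log2 {R : realType} (x : R) : R := ln x / ln 2.

Definition Phi (R : realType) (n l : nat) : R :=
  2 ^+ 40 * l%:R * n%:R `^ (38 + 8 * log2 n%:R).

(* Main.v *)
Require Import Defs.
From mathcomp Require Import all_boot all_order all_algebra.
From mathcomp Require Import classical_sets boolp reals exp.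
From mathcomp Require Import zify lra.

Set Implicit Arguments.
Unset Strict Implicit.
Unset Printing Implicit Defensive.

Import Order.TTheory GRing.Theory Num.Theory.

(** Let [w] be a word that is not [n]-divisible, [n >= 2], and let [M = 2 ^ m]
    be the power of two with [4 n <= M < 8 n].

    Colouring.  If positions [i_1, .., i_n] of [w] lie at least [M] apart and
    the windows of length [M] at these positions decrease, then [w] is
    [n]-divisible: cut [w] at the [i_k].  By Mirsky's theorem the positions
    have a colouring in [n - 1] colours such that, among positions of one
    colour lying at least [M] apart, windows never decrease.  Let the class of
    a position be its residue mod [M] together with its colour; distinct
    positions of one class are at least [M] apart, so for every [a <= M] the
    windows of length [a] grow weakly along each of the [p = M (n - 1)]
    classes.

    Doubling.  Let [V a] be the number of pairs (class, window of length [a] at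
    a position of this class).  Obviously [V 1 <= p l].  A window of length
    [2 a] at [i] is the concatenation of the windows of length [a] at [i] and
    at [i + a].  Fix the classes of [i] and [i + a]: as [i] grows, both halves
    grow weakly, so the pair of halves runs through a chain of a product of two
    chains, and takes at most as many values as the two chains together have
    elements -- a sum, where a product could be feared
    ([size_class_windowsD]).  Hence [V (2 a) <= 2 p V a], and
    [V M <= p l (2 p) ^ m] ([window_count_pow]), where [m] is about [log2 n].

    Repetitions.  If a word [u] of length [M] does not become periodic, with
    period less than [n], from its position [n - 1] on, then its [n] first
    tails are pairwise comparable.  Then [u] occurs fewer than [n] times in a
    class: in [n] disjoint occurrences one could start the factors at the
    tails of [u] taken in decreasing order.  So at most [(n - 1) V M] positions
    of [w] start such a window ([count_aperiodic]).

    Parsing.  Read [w] from left to right.  Where a window of length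
    [L = M - n + 1] has a period [q < n], cut off the longest [q]-periodic
    prefix, which is a power of a word of length [q] and a remainder;
    elsewhere cut off a letter.  Every cut passes a position whose window has
    no period less than [n]: by the argument of Fine and Wilf, the window of
    length [L] that sticks out of a maximal run by one letter is such
    ([power_factorization]).  The height is thus at most about
    [2 n V M], which is below [2 ^ 17 l n ^ (7 + 2 m)] with [m <= log2 n + 3]. *)

(** * Windows and divisibility *)

Section Windows.
Context {T : Type}.
Implicit Type w : seq T.

Definition window w i m := take m (drop i w).

Definition positions w m := iota 0 ((size w).+1 - m).

Lemma mem_positions w m i : (i \in positions w m) = (i + m <= size w).
Proof. by rewrite mem_iota; apply/idP/idP; lia. Qed.

Lemma size_window w i m : i + m <= size w -> size (window w i m) = m.
Proof. by move=> iw; rewrite size_takel// size_drop; lia. Qed.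

End Windows.

Section Division.
Context {d : Order.disp_t} {A : orderType d}.
Implicit Types (u v w : seq A).

Lemma lex_gt_prefix u v u' v' :
  prefix u u' -> prefix v v' -> lex_gt u v -> lex_gt u' v'.
Proof.
move=> /prefixP[x ->] /prefixP[y ->] /lex_gtP[p [a [b [s [t [-> -> ba]]]]]].
by apply/lex_gtP; exists p, a, b, (s ++ x), (t ++ y); rewrite -!catA.
Qed.

(** Words of the same length are incomparable only when they are equal. *)
Lemma lex_leNgt u v : size u = size v ->
  ~~ lex_gt u v -> (u <= v :> seqlexi A)%O.
Proof.
move=> uv; have [->//|neq] := eqVneq u v.
rewrite /lex_gt /word_comparable leNgt.
have pre x y : size x = size y -> prefix x y -> x = y :> seq A.
  by move=> /eqP sxy; rewrite prefixE => /eqP <-; rewrite take_oversize// (eqP sxy).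
case: (boolP (prefix u v)) => [/(pre _ _ uv) E|_]; first by rewrite E eqxx in neq.
case: (boolP (prefix v u)) => [/(pre _ _ (esym uv)) E|_]; first by rewrite E eqxx in neq.
by [].
Qed.

(** A pair [(i, m)] stands for the window of length [m] at [i]. *)
Definition window_gt w (p q : nat * nat) :=
  (p.1 + p.2 <= q.1) && lex_gt (window w p.1 p.2) (window w q.1 q.2).

(** The factor starting at each window runs up to the next one, and the last
    factor up to the end of the word.  Each factor thus has its window as a
    prefix, and a comparison decided by two prefixes is inherited. *)
Lemma window_chain_factors w p s : path (window_gt w) p s ->
  exists u us, [/\ drop p.1 w = flatten (u :: us), size us = size s,
    sorted lex_gt (u :: us) & prefix (window w p.1 p.2) u].
Proof.
elim: s p => [|q s IH] p /=.
  by move=> _; exists (drop p.1 w), [::]; rewrite /= cats0 prefix_take.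
move=> /andP[/andP[pq gt] /IH[u [us [eq sz srt pre]]]].
have pre' : prefix (window w p.1 p.2) (take (q.1 - p.1) (drop p.1 w)).
  rewrite /window -[take p.2 _](@take_takel _ p.2 (q.1 - p.1)) ?prefix_take//.
  by lia.
exists (take (q.1 - p.1) (drop p.1 w)), (u :: us); split => //=.
- have -> : u ++ flatten us = drop (q.1 - p.1) (drop p.1 w).
    by rewrite drop_drop subnK -?eq //; lia.
  by rewrite cat_take_drop.
- by rewrite sz.
- by rewrite (lex_gt_prefix pre' pre gt).
Qed.

Lemma window_chain_divisible n w (s : seq (nat * nat)) :
  0 < n -> size s = n -> sorted (window_gt w) s -> n_divisible n w.
Proof.
case: s => [|p s] /= n0 sz; first by rewrite -sz in n0.
move=> /window_chain_factors[u [us [eq szu srt _]]].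
have szt : size (u :: us) == n by rewrite /= szu sz.
by exists (take p.1 w), (Tuple szt); rewrite /= -[u ++ _]eq cat_take_drop.
Qed.

End Division.

(** * Mirsky's theorem *)

(** The colour of [x] is the length of a longest path starting at [x]; an edge
    from [x] to [y] prolongs every path starting at [y]. *)
Lemma mirsky_colouring (T : finType) (e : rel T) (k : nat) :
  (forall x t, path e x t -> size t != k) ->
  exists f : T -> 'I_k, forall x y, e x y -> f x != f y.
Proof.
move=> nochain.
have k0 (x : T) : 0 < k by have := nochain x [::] isT; rewrite lt0n eq_sym.
pose long x := [pred j : 'I_k | [exists t : j.-tuple T, path e x t]].
pose f x := \max_(j in long x) (j : nat).
have f_lt x : f x < k.
  by rewrite -(prednK (k0 x)) ltnS; apply/bigmax_leqP => j _; rewrite -ltnS prednK ?k0.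
exists (fun x => Ordinal (f_lt x)) => x y exy; rewrite -val_eqE /=.
have long_y : 0 < #|long y|.
  by apply/card_gt0P; exists (Ordinal (k0 y)); apply/existsP; exists [tuple].
have [j /existsP[t yt] fy] := eq_bigmax_cond (fun j : 'I_k => j : nat) long_y.
have xt : path e x (y :: t) by rewrite /= exy.
have j1 : j.+1 < k.
  by rewrite ltn_neqAle ltn_ord andbT; have := nochain _ _ xt; rewrite /= size_tuple.
suff : j.+1 <= f x by rewrite /(f y) fy; case: ltngtP.
apply: (bigop.bigmax_sup (Ordinal j1)) => //.
by apply/existsP; exists [tuple of y :: t].
Qed.

(** * Two counting lemmas *)

Lemma count_lt_mono (dT : Order.disp_t) (T : orderType dT) (r : seq T) (t t' : T) :
  (t <= t')%O -> count (fun x => (x < t)%O) r <= count (fun x => (x < t')%O) r.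
Proof. by move=> tt'; apply: sub_count => x /= xt; apply: lt_le_trans tt'. Qed.

Lemma count_lt_strict (dT : Order.disp_t) (T : orderType dT) (r : seq T) (t t' : T) :
  t \in r -> (t < t')%O -> count (fun x => (x < t)%O) r < count (fun x => (x < t')%O) r.
Proof.
move=> tr tt'; rewrite -(size_filter (fun x => (x < t')%O)).
have: count (fun x => (x < t)%O) r = count (fun x => (x < t)%O) [seq x <- r | (x < t')%O].
  rewrite count_filter; apply: eq_count => x /=.
  by case: ltP => //= xt; rewrite (lt_trans xt).
move=> ->; rewrite ltn_neqAle count_size andbT -all_count.
by apply/allPn; exists t; rewrite ?ltxx// mem_filter tt'.
Qed.

(** The sum of the ranks of the two coordinates is injective on a chain of the
    product order, and is less than the sum of the sizes. *)
Lemma size_chain (dX dY : Order.disp_t) (X : orderType dX) (Y : orderType dY)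
    (s : seq (X * Y)) (xs : seq X) (ys : seq Y) :
  uniq s -> (forall z, z \in s -> z.1 \in xs /\ z.2 \in ys) ->
  (forall z z', z \in s -> z' \in s ->
     (z.1 <= z'.1)%O /\ (z.2 <= z'.2)%O \/ (z'.1 <= z.1)%O /\ (z'.2 <= z.2)%O) ->
  size s <= size xs + size ys.
Proof.
move=> us sub chain.
pose rank z := count (fun x => (x < z.1)%O) xs + count (fun y => (y < z.2)%O) ys.
have strict z z' : z \in s -> z != z' -> (z.1 <= z'.1)%O -> (z.2 <= z'.2)%O ->
    rank z < rank z'.
  move=> /sub[z1 z2]; case: z z' z1 z2 => x y [x' y'] /= xxs yys.
  rewrite xpair_eqE negb_and => ne xx' yy'; rewrite /rank /=.
  case/orP: ne => ne.
    rewrite -addSn; apply: leq_add; last exact: count_lt_mono.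
    by apply: count_lt_strict; rewrite // lt_neqAle xx' andbT.
  rewrite -addnS; apply: leq_add; first exact: count_lt_mono.
  by apply: count_lt_strict; rewrite // lt_neqAle yy' andbT.
have inj : {in s &, injective rank}.
  move=> z z' zs z's; have [//|ne] := eqVneq z z'.
  have ne' : z' != z by rewrite eq_sym.
  case: (chain _ _ zs z's) => -[le1 le2].
    by move=> eq_rank; have := strict _ _ zs ne le1 le2; rewrite eq_rank ltnn.
  by move=> eq_rank; have := strict _ _ z's ne' le1 le2; rewrite eq_rank ltnn.
rewrite -(size_map rank) -[leqRHS](size_iota 0); apply: uniq_leq_size.
  by rewrite map_inj_in_uniq.
move=> _ /mapP[z zs ->]; rewrite mem_iota add0n /=; have [z1 z2] := sub _ zs.
rewrite /rank -addSn leq_add ?count_size//.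
rewrite ltn_neqAle count_size andbT -all_count.
by apply/allPn; exists z.1; rewrite ?ltxx.
Qed.

Lemma size_fibres (T K : eqType) (key : T -> K) (b : nat) (s : seq T) :
  (forall y, count (fun x => key x == y) s <= b) ->
  size s <= b * size (undup (map key s)).
Proof.
move=> le_b.
have -> : size s = \sum_(y <- undup (map key s)) count (fun x => key x == y) s.
  under eq_bigr do rewrite -sum1_count big_mkcond /=.
  rewrite exchange_big /= -sum1_size !big_seq; apply: eq_bigr => x xs.
  rewrite (bigD1_seq (key x)) ?undup_uniq ?mem_undup ?map_f//= eqxx big1 ?addn0// => y.
  by rewrite eq_sym => /negPf ->.
by rewrite -sum1_size big_distrr; apply: leq_sum => y _; rewrite /= muln1.
Qed.

(** * Number of windows along monotone classes *)

Section Counting.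
Context {d : Order.disp_t} {A : finOrderType d} {C : finType}.
Context (w : seq A) (cls : nat -> C).

(** Typed as [seqlexi] words, since the windows of a class will be compared in
    the total lexicographic order, which agrees with the partial one on words
    of equal length. *)
Definition class_windows a c : seq (seqlexi A) :=
  undup [seq window w i a | i <- positions w a & cls i == c].

Lemma class_windowsP a c i : i + a <= size w -> cls i = c ->
  (window w i a : seqlexi A) \in class_windows a c.
Proof.
move=> ia ic; rewrite mem_undup; apply: map_f.
by rewrite mem_filter ic eqxx mem_positions.
Qed.

Definition monotone_windows a := forall i j, i < j -> cls i = cls j ->
  j + a <= size w -> (window w i a <= window w j a :> seqlexi A)%O.

Lemma size_class_windows1 c : size (class_windows 1 c) <= #|A|.
Proof.
rewrite cardE -(size_map (fun x => [:: x] : seqlexi A)).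
apply: uniq_leq_size (undup_uniq _) _ => u.
rewrite mem_undup => /mapP[i]; rewrite mem_filter mem_positions => /andP[_ iw] ->.
apply/mapP; rewrite /window; case E: (drop i w) => [|x r].
  by have := congr1 size E; rewrite size_drop /=; lia.
by exists x; rewrite ?mem_enum//= take0.
Qed.

(** For each class [c'], the positions [i] of class [c] with [i + a] of class
    [c'] give pairs of half-windows that form a chain, because both halves grow
    with [i]. *)
Lemma size_class_windowsD a c : monotone_windows a ->
  size (class_windows (a + a) c) <=
    \sum_(c' : C) (size (class_windows a c) + size (class_windows a c')).
Proof.
move=> mono.
pose pos c' := [seq i <- positions w (a + a) | (cls i == c) && (cls (i + a) == c')].
pose pair i : seqlexi A * seqlexi A := (window w i a, window w (i + a) a).
pose pairs c' := undup [seq pair i | i <- pos c'].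
have le_pairs c' : size (pairs c') <=
    size (class_windows a c) + size (class_windows a c').
  have posP i : i \in pos c' -> [/\ i + a + a <= size w, cls i = c & cls (i + a) = c'].
    by rewrite mem_filter mem_positions addnA => /andP[/andP[/eqP-> /eqP->] ->].
  have le2 i j : i \in pos c' -> j \in pos c' -> i <= j ->
      ((pair i).1 <= (pair j).1)%O /\ ((pair i).2 <= (pair j).2)%O.
    move=> /posP[_ ic ic'] /posP[jw jc jc']; rewrite leq_eqVlt => /predU1P[->//|ij].
    by split; apply: mono; rewrite ?ltn_add2r ?ic ?ic'//; lia.
  apply: size_chain (undup_uniq _) _ _ => [z|z z'].
    rewrite mem_undup => /mapP[i /posP[iw ic ic'] ->].
    by split; apply: class_windowsP => //; lia.
  rewrite !mem_undup => /mapP[i ip ->] /mapP[j jp ->].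
  by case/orP: (leq_total i j) => ij; [left|right]; apply: le2.
apply: leq_trans (leq_sum _ (fun c' _ => le_pairs c')).
pose joined : seq (seqlexi A) :=
  flatten [seq [seq (z.1 : seq A) ++ z.2 | z <- pairs c'] | c' <- enum C].
have -> : \sum_c' size (pairs c') = size joined.
  rewrite size_flatten /shape -map_comp sumnE big_map enumT.
  by apply: eq_bigr => c' _; rewrite /= size_map.
apply: uniq_leq_size (undup_uniq _) _ => u.
rewrite mem_undup => /mapP[i]; rewrite mem_filter => /andP[ic iw] ->.
apply/flatten_mapP; exists (cls (i + a)); rewrite ?mem_enum//.
apply/mapP; exists (pair i).
  by rewrite mem_undup; apply: map_f; rewrite mem_filter ic eqxx iw.
by rewrite /= /window takeD drop_drop addnC.
Qed.

Definition window_count a := \sum_(c : C) size (class_windows a c).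

Lemma window_count_pow m :
  (forall k, k < m -> monotone_windows (2 ^ k)) ->
  window_count (2 ^ m) <= #|C| * #|A| * (2 * #|C|) ^ m.
Proof.
elim: m => [_|m IH mono].
  rewrite muln1 -sum_nat_const; apply: leq_sum => c _; exact: size_class_windows1.
apply: (@leq_trans (2 * #|C| * window_count (2 ^ m))); last first.
  rewrite expnS mulnCA leq_mul2l IH ?orbT// => k km; exact/mono/ltnW.
rewrite expnS mul2n -addnn.
apply: leq_trans (leq_sum _ (fun c _ => size_class_windowsD c (mono m (ltnSn m)))) _.
under eq_bigr do rewrite big_split /= sum_nat_const.
by rewrite big_split /= sum_nat_const -big_distrr /= -mulnA mul2n -addnn.
Qed.

End Counting.

(** * Windows without small period *)

Lemma prefix_drop (T : eqType) r (u v : seq T) : prefix u v -> prefix (drop r u) (drop r v).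
Proof.
move=> /prefixP[s ->]; rewrite drop_cat; case: ltnP => [_|ru]; first exact: prefix_prefix.
by rewrite drop_oversize ?prefix0s.
Qed.

(** [prefix (drop q v) v] says that [q] is a period of [v]; in particular every
    [q >= size v] is one, so an aperiodic word has length at least [n] when
    [n > 1]. *)
Definition aperiodic (T : eqType) n (v : seq T) :=
  all (fun q => ~~ prefix (drop q v) v) (iota 1 n.-1).

Section Occurrences.
Context {d : Order.disp_t} {A : finOrderType d}.
Implicit Types (u v w : seq A).

(** If a tail of [u] is a prefix of an earlier tail, the distance between the
    two is a period of the earlier tail, and of all tails after it. *)
Lemma aperiodic_tails n u o o' : aperiodic n (drop n.-1 u) -> n <= size u ->
  o < n -> o' < n -> o != o' -> word_comparable (drop o u) (drop o' u).
Proof.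
move=> /allP aper nu.
wlog oo' : o o' / o < o'.
  move=> H on on' ne; case: (ltngtP o o') => [oo'|oo'|oo'].
  - exact: H.
  - by rewrite /word_comparable andbC; apply: H; rewrite // eq_sym.
  - by rewrite oo' eqxx in ne.
move=> on on' _; apply/andP; split.
  have lt_tail k : n <= k -> ~ (k - o <= k - o') by lia.
  by apply/negP => /size_prefix; rewrite !size_drop; apply: lt_tail.
apply/negP => /(prefix_drop (n.-1 - o)); apply/negP.
have /aper : o' - o \in iota 1 n.-1 by rewrite mem_iota; lia.
rewrite !drop_drop.
have -> : o' - o + n.-1 = n.-1 - o + o' by lia.
by have -> : n.-1 - o + o = n.-1 by lia.
Qed.

Lemma aperiodic_order n u : aperiodic n (drop n.-1 u) -> n <= size u ->
  exists2 os, perm_eq os (iota 0 n) &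
    sorted (fun o o' => lex_gt (drop o u) (drop o' u)) os.
Proof.
move=> aper nu.
pose ge o o' := (drop o' u <= drop o u :> seqlexi A)%O.
have ge_total : total ge by move=> o o'; apply: le_total.
have ge_trans : transitive ge by move=> o2 o1 o3 h1 h2; apply: le_trans h2 h1.
exists (sort ge (iota 0 n)); first by rewrite perm_sort.
apply: pairwise_sorted.
have : pairwise [rel o o' | ge o o' && (o != o')] (sort ge (iota 0 n)).
  by rewrite pairwise_relI -sorted_pairwise// sort_sorted//= -uniq_pairwise sort_uniq iota_uniq.
apply: (@sub_in_pairwise _ (fun o => o < n)); last first.
  by apply/allP => o; rewrite mem_sort mem_iota.
move=> o o' /= on on' /andP[ge_oo' ne]; have cmp := aperiodic_tails aper nu on on' ne.
rewrite /lex_gt cmp /= lt_neqAle; apply/andP; split=> //; apply/negP => /eqP eq_tail.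
by move: cmp; rewrite /word_comparable eq_tail prefix_refl.
Qed.

(** The [k]-th factor starts in the [k]-th occurrence of [u], at the [k]-th
    largest of the first [n] tails of [u]; the comparisons are decided before
    the occurrence ends. *)
Lemma occurrences_divisible n M w u (ps : seq nat) :
  0 < n -> aperiodic n (drop n.-1 u) -> n <= size u -> size u = M ->
  size ps = n -> sorted (fun i j => i + M <= j) ps ->
  (forall i, i \in ps -> window w i M = u) -> n_divisible n w.
Proof.
move=> n0 aper nu uM szi /(sortedP 0) spaced occ.
have [os perm_os /(sortedP 0) dec] := aperiodic_order aper nu.
have szo : size os = n by rewrite (perm_size perm_os) size_iota.
have os_lt k : k < n -> nth 0 os k < n.
  by move=> kn; have := mem_nth 0 (_ : k < size os); rewrite szo (perm_mem perm_os) mem_iota => /(_ kn).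
pose mark k := (nth 0 ps k + nth 0 os k, M - nth 0 os k).
have mark_window k : k < n -> window w (mark k).1 (mark k).2 = drop (nth 0 os k) u.
  move=> kn; rewrite -(occ (nth 0 ps k)) ?mem_nth ?szi// /window /mark /=.
  have oM : nth 0 os k <= M by have := os_lt k kn; lia.
  by rewrite -[in RHS](subnK oM) -take_drop drop_drop addnC.
apply: (@window_chain_divisible _ _ _ _ (mkseq mark n)) => //; first by rewrite size_mkseq.
apply/(sortedP (0, 0)) => k; rewrite size_mkseq => kn; have kn' := ltnW kn.
rewrite !nth_mkseq//; apply/andP; split.
  by have := spaced k; rewrite szi => /(_ kn); have := os_lt k kn'; rewrite /mark /=; lia.
by rewrite !mark_window//; apply: dec; rewrite szo.
Qed.

(** A path with [n] vertices in the relation to be coloured would divide the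
    word into [n] decreasing factors; hence [n.-1] colours are enough. *)
Lemma separating_colouring n M w : 0 < n -> ~ n_divisible n w ->
  exists f : nat -> 'I_n.-1, forall i j, i + M <= j -> j <= size w -> f i = f j ->
    ~~ lex_gt (window w i M) (window w j M).
Proof.
move=> n0 ndiv.
pose e := [rel i j : 'I_(size w).+1 | window_gt w (i : nat, M) (j : nat, M)].
have nochain x t : path e x t -> size t != n.-1.
  move=> xt; apply/negP => /eqP szt; apply: ndiv.
  apply: (@window_chain_divisible _ _ _ _ [seq (i : nat, M) | i : 'I_(size w).+1 <- x :: t]) => //.
    by rewrite size_map /= szt prednK.
  by rewrite /= path_map.
have [f fP] := mirsky_colouring nochain; exists (fun i => f (inord i)) => i j ij jw fij.
apply/negP => gt.
suff /fP : e (inord i) (inord j) by rewrite fij eqxx.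
rewrite /= /window_gt !inordK ?ltnS//= ?ij//; lia.
Qed.

(** There are [M * n.-1] classes (residue, colour), and in each of them an
    aperiodic window has at most [n.-1] occurrences. *)
Lemma count_aperiodic n M w : 1 < n -> n <= M -> ~ n_divisible n w ->
  forall m, M = 2 ^ m ->
  count (fun i => aperiodic n (drop n.-1 (window w i M))) (positions w M) <=
    n.-1 * (M * n.-1 * #|A| * (2 * (M * n.-1)) ^ m).
Proof.
move=> n1 nM ndiv m defM; have n0 := ltnW n1; have M0 := leq_trans n0 nM.
have [f fP] := separating_colouring M n0 ndiv.
pose cls i := (Ordinal (ltn_pmod i M0), f i).
(* Equal residues mod [M] keep the positions of a class at least [M] apart. *)
have spaced i j : i < j -> cls i = cls j -> i + M <= j.
  move=> ij [/eqP eq_res _]; have : M %| j - i by rewrite -eqn_mod_dvd ?(ltnW ij)// eq_sym.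
  by move/dvdn_leq; lia.
have mono a : a <= M -> monotone_windows w cls a.
  move=> aM i j ij cij jw; have iw : i + a <= size w by lia.
  apply: lex_leNgt; first by rewrite !size_window.
  have := fP i j (spaced _ _ ij cij) _ (congr1 snd cij); move/(_ ltac:(lia)).
  have pre k : prefix (window w k a) (window w k M).
    by rewrite /window -[take a _](take_takel _ aM) prefix_take.
  by apply: contra; apply: lex_gt_prefix.
have mono_pow k : k < m -> monotone_windows w cls (2 ^ k).
  by move=> km; apply: mono; rewrite defM leq_exp2l// ltnW.
have := window_count_pow mono_pow; rewrite -defM card_prod !card_ord => le_count.
apply: leq_trans (leq_mul (leqnn _) le_count).
rewrite -size_filter big_distrr /=; set s := filter _ _.
have -> : size s = \sum_c size [seq i <- s | cls i == c].
  under eq_bigr do rewrite size_filter -sum1_count big_mkcond /=.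
  rewrite exchange_big /= -sum1_size; apply: eq_bigr => i _.
  by rewrite (bigD1 (cls i))//= eqxx big1 ?addn0// => c; rewrite eq_sym => /negPf ->.
apply: leq_sum => c _.
set sc := filter _ s.
have scP i : i \in sc ->
    [/\ cls i = c, aperiodic n (drop n.-1 (window w i M)) & i + M <= size w].
  by rewrite !mem_filter mem_positions => /andP[/eqP -> /andP[-> ->]].
(* With [n] occurrences of [y] in the class, the first [n] of them would give
   an [n]-division. *)
have fibre y : count (fun i => window w i M == y) sc <= n.-1.
  rewrite -ltnS prednK// ltnNge; apply/negP => big; apply: ndiv.
  rewrite -size_filter in big; set ps := filter _ sc in big.
  have psP i : i \in ps -> window w i M = y /\ i \in sc.
    by rewrite mem_filter => /andP[/eqP].
  have sorted_ps : sorted ltn (take n ps).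
    by apply: take_sorted; do 3! apply: (sorted_filter ltn_trans); apply: iota_ltn_sorted.
  have [i0 i0ps] : exists i0, i0 \in ps.
    by case: (ps) big => [|i0 r] /= big; [rewrite leqNgt n0 in big | exists i0; rewrite mem_head].
  have [y0 /scP[_ ap0 iw0]] := psP _ i0ps; rewrite y0 in ap0.
  have szy : size y = M by rewrite -y0 size_window.
  apply: (@occurrences_divisible n M w y (take n ps)) => //; first by rewrite szy.
  - by rewrite size_takel.
  - apply: (sub_in_sorted _ (allss _) sorted_ps) => i j /mem_take iin /mem_take jin ij.
    have [_ /scP[ci _ _]] := psP _ iin; have [_ /scP[cj _ _]] := psP _ jin.
    by apply: spaced => //; rewrite ci cj.
  - by move=> i /mem_take /psP[].
apply: leq_trans (size_fibres fibre) _; rewrite leq_mul2l; apply/orP; right.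
apply: uniq_leq_size (undup_uniq _) _ => u.
rewrite mem_undup => /mapP[i /scP[ci _ iw] ->]; exact: class_windowsP.
Qed.

End Occurrences.

(** * Factorization into powers of short words *)

Section Parsing.
Context {d : Order.disp_t} {A : orderType d}.
Implicit Types (u v w : seq A).

Lemma periodP q v x0 :
  reflect (forall i, i + q < size v -> nth x0 v (i + q) = nth x0 v i)
          (prefix (drop q v) v).
Proof.
rewrite prefixE size_drop; apply: (iffP eqP) => [eqv i iv|per].
  by rewrite -[in RHS](nth_take _ (_ : i < size v - q)) ?eqv ?nth_drop 1?addnC//; lia.
have szt : size (take (size v - q) v) = size (drop q v).
  by rewrite size_drop size_takel//; lia.
apply: (eq_from_nth (x0 := x0)) => // i; rewrite szt size_drop => iv.
by rewrite nth_take// nth_drop addnC per//; lia.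
Qed.

Lemma period_power q v : 0 < q -> prefix (drop q v) v ->
  exists k r, size r < q /\ v = word_exp (take q v) k ++ r.
Proof.
move=> q0; have [m] := ubnP (size v); elim: m v => // m IH v vm per.
case: (ltnP (size v) q) => [vq|qv]; first by exists 0, v.
have /IH[|k [r [rq eqv]]] : size (drop q v) < m by rewrite size_drop; lia.
  exact: prefix_drop.
case: (ltnP (size (drop q v)) q) => [short|long].
  by exists 1, (drop q v); rewrite /word_exp /= cats0 cat_take_drop.
exists k.+1, r; split=> //.
rewrite /word_exp /= -catA -/(word_exp _ _).
suff -> : word_exp (take q v) k ++ r = drop q v by rewrite cat_take_drop.
rewrite [RHS]eqv; congr (word_exp _ _ ++ _).
move: per; rewrite prefixE => /eqP per.
by rewrite -[in RHS]per take_takel.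
Qed.

Definition aperiodic_count n L w :=
  count (fun j => aperiodic n (window w j L)) (positions w L).

Lemma aperiodic_count_drop n L w e j : 0 < L -> j < e -> j + L <= size w ->
  aperiodic n (window w j L) -> aperiodic_count n L (drop e w) < aperiodic_count n L w.
Proof.
move=> L0 je jw aper; rewrite /aperiodic_count /positions size_drop.
have [eK|Ke] := leqP e ((size w).+1 - L); last first.
  have -> : (size w - e).+1 - L = 0 by lia.
  rewrite -has_count; apply/hasP; exists j => //; rewrite mem_iota; lia.
have -> : (size w).+1 - L = e + ((size w - e).+1 - L) by lia.
have shift k : iota e k = [seq e + i | i <- iota 0 k] by rewrite -iotaDl addn0.
rewrite iotaD add0n count_cat shift count_map.
have /eq_count -> : preim (addn e) (fun i => aperiodic n (window w i L)) =1
    (fun i => aperiodic n (window (drop e w) i L)).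
  by move=> i /=; rewrite /window drop_drop addnC.
rewrite -[X in X < _]add0n ltn_add2r -has_count; apply/hasP; exists j => //.
by rewrite mem_iota.
Qed.

Lemma longest_run q L w : 0 < q -> L <= size w -> prefix (drop q (window w 0 L)) (window w 0 L) ->
  exists e, [/\ L <= e <= size w, prefix (drop q (take e w)) (take e w) &
    e < size w -> ~~ prefix (drop q (take e.+1 w)) (take e.+1 w)].
Proof.
move=> q0 Lw; rewrite /window drop0 => per.
pose P e := (e <= size w) && prefix (drop q (take e w)) (take e w).
have exP : exists e, P e by exists L; rewrite /P Lw.
have ubP e : P e -> e <= size w by case/andP.
case: (ex_maxnP exP ubP) => e /andP[ew pe] maxe; exists e; split=> //.
  by rewrite ew andbT maxe// /P Lw.
move=> ew'; apply/negP => pe'.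
by have := maxe e.+1; rewrite /P ew' pe' ltnn => /(_ isT).
Qed.

(** Suppose that the letters [w_0 .. w_(e-1)] have period [q], and that the last
    window of length [L] of [w_0 .. w_e] has period [q'].  This window is long
    enough for [w_e = w_(e-q') = w_(e-q'-q) = w_(e-q)], so that the run of
    period [q] would extend to [w_e]. *)
Lemma run_end_aperiodic n q L e w : 0 < q < n -> n.*2 <= L.+1 -> L <= e < size w ->
  prefix (drop q (take e w)) (take e w) ->
  ~~ prefix (drop q (take e.+1 w)) (take e.+1 w) ->
  aperiodic n (window w (e.+1 - L) L).
Proof.
move=> /andP[q0 qn] nL /andP[Le ew]; have [x0 _] : exists x : A, True.
  by case: (w) ew => [|x ?] // _; exists x.
move=> /(periodP _ _ x0) per /negP nper; apply/allP => q'; rewrite mem_iota => /andP[q'0 q'n].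
have szw : size (window w (e.+1 - L) L) = L by rewrite size_window//; lia.
apply/negP => /(periodP _ _ x0) per'; apply: nper; apply/(periodP _ _ x0) => i.
have nth_e k : k < e -> nth x0 (take e w) k = nth x0 w k by move=> ke; rewrite nth_take.
have nth_e1 k : k < e.+1 -> nth x0 (take e.+1 w) k = nth x0 w k by move=> ke; rewrite nth_take.
have per_w k : k + q < e -> nth x0 w (k + q) = nth x0 w k.
  by move=> ke; rewrite -nth_e// per ?size_takel ?nth_e//; lia.
have per'_w k : e.+1 - L <= k -> k + q' < e.+1 -> nth x0 w (k + q') = nth x0 w k.
  move=> Lk ke; have := per' (k - (e.+1 - L)); rewrite szw /window.
  rewrite !nth_take ?nth_drop; try lia.
  have -> : e.+1 - L + (k - (e.+1 - L) + q') = k + q' by lia.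
  have -> : e.+1 - L + (k - (e.+1 - L)) = k by lia.
  by apply; lia.
rewrite size_takel// => ie; rewrite !nth_e1; try lia.
have [iqe|iqe] := ltnP (i + q) e; first exact: per_w.
have {iqe} ie' : i + q = e by lia.
(* Here [i + q = e]: the chain of equalities stated above the lemma. *)
have -> : i + q = i - q' + q + q' by lia.
rewrite per'_w; try lia; rewrite per_w; last by lia.
by rewrite -per'_w; [congr nth|..]; lia.
Qed.

Lemma singletons w n : 1 < n -> exists s : seq (seq A * nat),
  [/\ size s = size w, forall p, p \in s -> size p.1 < n
    & w = flatten [seq word_exp p.1 p.2 | p <- s]].
Proof.
move=> n1; exists [seq ([:: x], 1) | x <- w]; split; first by rewrite size_map.
  by move=> _ /mapP[x _ ->].
by rewrite -map_comp; elim: w => //= x w {1}->.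
Qed.

(** Every cut emits at most two factors and is charged to an aperiodic position
    that it passes; when fewer than [L] letters are left they are emitted one
    by one. *)
Lemma power_factorization n L w : 1 < n -> n.*2 <= L.+1 ->
  exists s : seq (seq A * nat),
    [/\ size s <= (aperiodic_count n L w).*2 + L, forall p, p \in s -> size p.1 < n
      & w = flatten [seq word_exp p.1 p.2 | p <- s]].
Proof.
move=> n1 nL; have [m] := ubnP (size w); elim: m w => // m IH w wm.
have [wL|Lw] := ltnP (size w) L.
  by have [s [szs ps eqs]] := singletons w n1; exists s; split=> //; rewrite szs; lia.
(* Cut off the prefix of length [e], factored by [s0], and charge the cut to
   the aperiodic position [j]. *)
have extend e j s0 : 0 < e <= size w -> j < e -> j + L <= size w ->
    aperiodic n (window w j L) -> size s0 <= 2 ->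
    (forall p, p \in s0 -> size p.1 < n) ->
    take e w = flatten [seq word_exp p.1 p.2 | p <- s0] ->
    exists s : seq (seq A * nat),
    [/\ size s <= (aperiodic_count n L w).*2 + L, forall p, p \in s -> size p.1 < n
      & w = flatten [seq word_exp p.1 p.2 | p <- s]].
  move=> e0 je jw aper szs0 ps0 eqs0.
  have /IH[s [szs ps eqs]] : size (drop e w) < m by rewrite size_drop; lia.
  have L0 : 0 < L by lia.
  have lt_count := aperiodic_count_drop L0 je jw aper.
  exists (s0 ++ s); split; first by rewrite size_cat; apply: leq_trans (leq_add szs0 szs) _; lia.
    by move=> p; rewrite mem_cat => /orP[/ps0|/ps].
  by rewrite map_cat flatten_cat -eqs0 -eqs cat_take_drop.
case: (boolP (aperiodic n (window w 0 L))) => [aper|].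
  have [x [r eqw]] : exists x r, w = x :: r.
    by case: (w) Lw => [|x r] /= L0; [exfalso; lia | exists x, r].
  apply: (extend 1 0 [:: ([:: x], 1)]) => //; first by rewrite eqw.
    by move=> p; rewrite inE => /eqP ->.
  by rewrite eqw /= take0.
case/allPn => q; rewrite mem_iota => qn; rewrite negbK => perq.
have q0 : 0 < q by case/andP: qn.
have [e [Lew per nper]] := longest_run q0 Lw perq.
have [k [r [rq eqe]]] := period_power q0 per.
pose s0 := [:: (take q (take e w), k); (r, 1)].
have ps0 p : p \in s0 -> size p.1 < n.
  by rewrite !inE => /orP[]/eqP -> /=; rewrite ?size_take_min; lia.
have eqs0 : take e w = flatten [seq word_exp p.1 p.2 | p <- s0].
  by rewrite /= cats0 [word_exp r 1]cats0.
have [ew|we] := ltnP e (size w).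
  apply: (extend e (e.+1 - L) s0) => //; try lia.
  by apply: (run_end_aperiodic (q := q)) per (nper ew) => //; lia.
exists s0; split=> //=; first by lia.
by rewrite -[LHS](take_oversize we).
Qed.

End Parsing.

(** * The height bound *)

(** A window of length [M - n.-1] at [j >= n.-1] is what remains of the window
    of length [M] at [j - n.-1] after its first [n.-1] letters; the first
    [n.-1] positions [j] are counted separately. *)
Lemma aperiodic_count_window (d : Order.disp_t) (A : orderType d) n M (w : seq A) :
  n <= M ->
  aperiodic_count n (M - n.-1) w <=
    n.-1 + count (fun i => aperiodic n (drop n.-1 (window w i M))) (positions w M).
Proof.
move=> nM; rewrite /aperiodic_count /positions.
set K := _ - (M - n.-1); have [Kn|nK] := leqP K n.-1.
  by apply: leq_trans (count_size _ _) _; rewrite size_iota; lia.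
have shift k : iota n.-1 k = [seq n.-1 + i | i <- iota 0 k] by rewrite -iotaDl addn0.
have -> : K = n.-1 + ((size w).+1 - M) by rewrite /K in nK *; lia.
rewrite iotaD add0n count_cat shift count_map leq_add//.
  by apply: leq_trans (count_size _ _) _; rewrite size_iota.
rewrite (eq_count (a2 := fun i => aperiodic n (drop n.-1 (window w i M))))// => i /=.
by congr (aperiodic n _); rewrite /window -drop_drop take_drop subnK//; lia.
Qed.

Lemma height_of_indivisible (d : Order.disp_t) (A : finOrderType d) n m :
  0 < #|A| -> 1 < n -> 4 * n <= 2 ^ m <= 8 * n ->
  height_at_most (~` (n_divisible n : set (seq A)))%classic (words_shorter_than n)
    (2 ^ 17 * #|A| * n ^ (7 + 2 * m)).
Proof.
move=> A0 n1 /andP[nM Mn] w ndiv; set M := 2 ^ m in nM Mn.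
have m0 : 0 < m by rewrite lt0n; apply/eqP => m0; move: nM; rewrite /M m0; lia.
have nL : n.*2 <= (M - n.-1).+1 by lia.
have [s [szs ps eqs]] := power_factorization w n1 nL.
exists s; split=> //; apply: leq_trans szs _.
have le_aper : aperiodic_count n (M - n.-1) w <=
    n + n * (M * n * #|A| * (2 * (M * n)) ^ m).
  apply: leq_trans (aperiodic_count_window w _) _; first by lia.
  apply: leq_add (leq_pred n) _.
  apply: leq_trans (count_aperiodic n1 _ ndiv (erefl M)) _; first by lia.
  have n_pred := leq_pred n; apply: leq_mul => //; apply: leq_mul.
    by rewrite leq_mul2r leq_mul2l n_pred !orbT.
  by rewrite leq_exp2r// !leq_mul2l n_pred !orbT.
(* The factor [2 M] in the base of the power is at most [16 n]; its [m]-th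
   power is polynomial in [n], because [2 ^ m <= 8 n]. *)
have le_pow : (2 * (M * n)) ^ m <= (8 * n) ^ 4 * n ^ (2 * m).
  have /leq_trans : (2 * (M * n)) ^ m <= (2 ^ 4 * n ^ 2) ^ m.
    by rewrite leq_exp2r//; nia.
  by apply; rewrite expnMn -!expnM leq_mul2r [(4 * m)%N]mulnC (expnM 2) leq_exp2r// Mn orbT.
have : 0 < (2 * (M * n)) ^ m by rewrite expn_gt0 !muln_gt0 expn_gt0 /= (ltnW n1).
move: (_ ^ m) => P in le_aper le_pow * => P0.
apply: (@leq_trans (2 ^ 5 * #|A| * n ^ 3 * P)).
  set X := n ^ 3 * (#|A| * P).
  have nX : n <= X.
    by rewrite /X expnS -mulnA leq_pmulr// !muln_gt0 ?expn_gt0 (ltnW n1) A0 P0.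
  have MX : n * (M * n * #|A| * P) <= 8 * X.
    have -> : 8 * X = n * (8 * n * n * #|A| * P) by rewrite /X !expnS; lia.
    by rewrite leq_mul2l !leq_mul2r Mn !orbT.
  have -> : 2 ^ 5 * #|A| * n ^ 3 * P = 32 * X by rewrite /X; lia.
  lia.
apply: leq_trans (leq_mul (leqnn _) le_pow) _.
by rewrite !expnMn !expnD; apply: eq_leq; lia.
Qed.

Lemma least_height (d : Order.disp_t) (A : orderType d) (S Y : set (seq A)) h0 :
  height_at_most S Y h0 -> exists2 h, has_height S Y h & h <= h0.
Proof.
move=> h0P.
have ex : exists k, `[< height_at_most S Y k >] by exists h0; apply/asboolP.
case: (ex_minnP ex) => h /asboolP hP minh; exists h; last exact/minh/asboolP.
by split=> // h' h'P; apply/minh/asboolP.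
Qed.

Local Open Scope ring_scope.

Lemma exponent_le_log2 (R : realType) (n m : nat) : (2 ^ m <= 8 * n)%N ->
  m%:R <= 3 + log2 n%:R :> R.
Proof.
move=> le_mn; have n0 : (0 < n)%N by case: n le_mn => //; rewrite muln0 leqNgt expn_gt0.
have ln2 : 0 < ln 2 :> R by rewrite ln_gt0// ltr1n.
rewrite /log2 -(ler_pM2r ln2) mulrDl divfK ?gt_eqF//.
rewrite !mulr_natl -!lnXn//.
rewrite -lnM ?posrE ?exprn_gt0 ?ltr0n//.
rewrite ler_ln ?posrE ?mulr_gt0 ?exprn_gt0 ?ltr0n//.
by rewrite -!natrX -natrM ler_nat.
Qed.

Lemma nat_bound_Phi (R : realType) (n m l : nat) : (1 < n)%N -> (2 ^ m <= 8 * n)%N ->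
  (2 ^ 17 * l * n ^ (7 + 2 * m))%N%:R <= Phi R n l.
Proof.
move=> n1 /(exponent_le_log2 R) le_m; rewrite /Phi natrM (natrM _ (2 ^ 17)) !natrX.
have n1R : 1 <= n%:R :> R by rewrite ler1n ltnW.
have log0 : 0 <= log2 n%:R :> R by rewrite divr_ge0 ?ln_ge0// ler1n.
have le1 : 2 ^+ 17 * l%:R <= 2 ^+ 40 * l%:R :> R.
  by rewrite ler_wpM2r ?ler0n// ler_weXn2l// ler1n.
have n_ge0 : 0 <= n%:R :> R := ler0n _ _.
apply: ler_pM le1 _; [by rewrite mulr_ge0 ?exprn_ge0 ?ler0n | exact: exprn_ge0 |].
rewrite -powR_mulrn ?ler0n//; apply: ler_powR => //.
rewrite natrD natrM; lra.
Qed.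

Local Open Scope classical_set_scope.

Theorem mainTheorem3 (R : realType) (n l : nat) (d : Order.disp_t)
    (A : finOrderType d) (n_gt0 : (0 < n)%N) (l_gt0 : (0 < l)%N)
    (cardA : #|A| = l) :
  exists h : nat,
    has_height (~` (n_divisible n : set (seq A))) (words_shorter_than n) h /\
    h%:R <= Phi R n l.
Proof.
have [h0 h0P h0_le] : exists2 h0 : nat,
    height_at_most (~` (n_divisible n : set (seq A))) (words_shorter_than n) h0 &
    h0%:R <= Phi R n l.
  have [n1|n1] := ltnP 1 n; last first.
    (* Every word is [1]-divisible, as its own single factor. *)
    have -> : n = 1%N by lia.
    exists 0%N; last by rewrite /Phi !mulr_ge0 ?exprn_ge0 ?powR_ge0.
    by move=> w []; exists [::], [tuple w]; rewrite /= cats0.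
  (* [2 ^ up_log 2 n] is the least power of two that is at least [n]; four
     times it lies between [4 n] and [8 n]. *)
  pose m := (up_log 2 n).+2.
  have /andP[lo hi] := @up_log_bounds 2 n isT n1.
  have up0 : (0 < up_log 2 n)%N by rewrite up_log_gt0.
  have /andP[le_m m_le] : (4 * n <= 2 ^ m <= 8 * n)%N.
    rewrite /m !expnS; move: lo; rewrite -(prednK up0) expnS /= in hi *; lia.
  exists (2 ^ 17 * l * n ^ (7 + 2 * m))%N; last exact: nat_bound_Phi.
  by rewrite -cardA; apply: height_of_indivisible; rewrite ?cardA// le_m.
have [h hP h_le] := least_height h0P; exists h; split=> //.
by apply: le_trans h0_le; rewrite ler_nat.
Qed.
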